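(* Let $\mathcal{G}=(V,\mathcal{E})$ be a hypergraph, $S$ a multiset of vertices of $V$, $\alpha,\beta,\gamma\in\mathbb{Z}_+$, $f,g:V\to\mathbb{Z}_+$ functions, and $\mathsf{M}=(S,r_{\mathsf{M}})$ a matroid. One can add $\gamma$ edges to $\mathcal{G}$ (i.e. there is a set $F$ of $\gamma$ edges on $V$) so that $(V,\mathcal{E}\cup F)$ has an $\mathsf{M}$-based $(f,g)$-bounded $(\alpha,\beta)$-limited packing of rooted hypertrees if and only if all of the following hold: (i) $f(v)\le\min\{r_{\mathsf{M}}(S_v),g(v)\}$ for every $v\in V$; (ii) $\alpha\le\beta$; (iii) $\alpha\le\sum_{v\in V}\min\{r_{\mathsf{M}}(S_v),g(v)\}$; (iv) $r_{\mathsf{M}}(S)-r_{\mathsf{M}}(S_Y)\le\min\{\beta-f(Y),g(V\setminus Y)\}$ for every $Y\subseteq V$; (v) $g(V)+\gamma+e_{\mathcal{E}}(\mathcal{P})\ge\sum_{X\in\mathcal{P}}\max\{r_{\mathsf{M}}(S)-r_{\mathsf{M}}(S_Y)+g(Y):Y\subseteq X\}$ for every partition $\mathcal{P}$ of $V$; (vi) $\beta+\gamma+e_{\mathcal{E}}(\mathcal{P})\ge\sum_{X\in\mathcal{P}}\max\{r_{\mathsf{M}}(S)-r_{\mathsf{M}}(S_Y)+f(Y):Y\subseteq X\}$ for every partition $\mathcal{P}$ of $V$.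
   Context: Edges are unordered pairs of distinct vertices (parallel edges allowed); hyperedges are subsets of $V$ of size at least two; $e_{\mathcal{E}}(\mathcal{P})$ is the number of hyperedges of $\mathcal{E}$ not contained in a single member of the partition $\mathcal{P}$. Trimming a hyperedge $Z$ means replacing it by an edge with both end-vertices in $Z$. $\mathbb{Z}_+$ is the non-negative integers; $h(X)=\sum_{x\in X}h(x)$. A multiset $S$ of vertices is a finite collection of vertices with multiplicities; $S_X$ is the set of elements of $S$ located in $X$, $S_v=S_{\{v\}}$; $r_{\mathsf{M}}$ is the rank function of $\mathsf{M}$. In a graph, a rooted tree is a tree (possibly a single vertex) with a designated root; a packing is a collection of pairwise edge-disjoint rooted trees; it is $\mathsf{M}$-based if each tree's root is assigned a distinct element of $S$ located at the root vertex and for every vertex $v$ the set of root-elements of the trees containing $v$ is a basis of $\mathsf{M}$; $(f,g)$-bounded if every $v$ is the root of at least $f(v)$ and at most $g(v)$ trees; $(\alpha,\beta)$-limited if the total number of roots is between $\alpha$ and $\beta$. A packing of rooted hypertrees in a hypergraph is a collection of pairs (root vertex, set of hyperedges), the hyperedge sets pairwise disjoint, whose hyperedges can be trimmed so that it becomes a packing of rooted trees; it is $\mathsf{M}$-based, $(f,g)$-bounded, $(\alpha,\beta)$-limited if it can be trimmed to a packing of rooted trees with these properties.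
   Formalization: The formal theorem additionally assumes that V has at least two vertices whenever γ > 0; with a single vertex no edge can be added, although conditions (i)–(vi) may hold, so the statement fails there. *)

(* Defs.v *)
From mathcomp Require Import all_boot all_order all_algebra.
Set Implicit Arguments. Unset Strict Implicit. Unset Printing Implicit Defensive.

(* Graphs and hypergraphs on V are families of subsets of V indexed by a
   finite type E, so parallel (hyper)edges are allowed, and an edge set is a
   {set E}. *)
Definition is_hypergraph (V E : finType) (H : E -> {set V}) : Prop :=
  forall e, 1 < #|H e|.

Definition is_graph (V E : finType) (D : E -> {set V}) : Prop :=
  forall e, #|D e| = 2.

Definition add_edges (V E E' : finType) (H : E -> {set V})
    (F : E' -> {set V}) (e : E + E') : {set V} :=
  match e with inl e1 => H e1 | inr e2 => F e2 end.

Definition trimming (V E : finType) (H D : E -> {set V}) : Prop :=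
  is_graph D /\ forall e, D e \subset H e.

Section Trees.
Variables (V E : finType) (D : E -> {set V}).

Definition adjacent (T : {set E}) : rel V :=
  fun x y => [exists e in T, D e == [set x; y]].

(* A cycle is given by its vertices and edges (v_1, e_1), ..., (v_k, e_k),
   where e_i joins v_i to v_(i+1) and indices are taken modulo k; two parallel
   edges form a cycle with k = 2. *)
Definition graph_cycle (T : {set E}) (c : seq (V * E)) : Prop :=
  [/\ c != [::], {subset map snd c <= T},
      uniq (map fst c), uniq (map snd c)
    & cycle (fun p q => D p.2 == [set p.1; q.1]) c].

Definition is_tree (U : {set V}) (T : {set E}) : Prop :=
  [/\ U != set0,
      forall e, e \in T -> D e \subset U,
      {in U &, forall x y, connect (adjacent T) x y}
    & forall c, ~ graph_cycle T c].

(* A rooted tree is the pair t of its root and its edge set. Its vertices are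
   the root and the ends of its edges; connectedness then forces the root to be
   an end of some edge as soon as there is one. *)
Definition tree_vertices (t : V * {set E}) : {set V} :=
  t.1 |: \bigcup_(e in t.2) D e.

Definition rooted_tree (t : V * {set E}) : Prop :=
  is_tree (tree_vertices t) t.2.

(* Packings are indexed families, since the same single-vertex tree may occur
   several times. *)
Definition tree_packing (n : nat) (P : 'I_n -> V * {set E}) : Prop :=
  (forall i, rooted_tree (P i)) /\
  (forall i j, i != j -> [disjoint (P i).2 & (P j).2]).

End Trees.

Record matroid (S : finType) := Matroid {
  rk :> {set S} -> nat;
  rk_card : forall X : {set S}, rk X <= #|X|;
  rk_mono : forall X Y : {set S}, X \subset Y -> rk X <= rk Y;
  rk_submod : forall X Y : {set S}, rk (X :&: Y) + rk (X :|: Y) <= rk X + rk Y }.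

Definition independent (S : finType) (M : matroid S) (X : {set S}) : bool :=
  M X == #|X|.

Definition basis (S : finType) (M : matroid S) (B : {set S}) : bool :=
  maxset (independent M) B.

(* A multiset of vertices is a finite type S of elements, each with a location
   loc s in V. *)
Definition located (V S : finType) (loc : S -> V) (X : {set V}) : {set S} :=
  loc @^-1: X.

Section Properties.
Variables (V E S : finType) (n : nat) (P : 'I_n -> V * {set E}).

Definition matroid_based (D : E -> {set V}) (loc : S -> V) (M : matroid S) :
    Prop :=
  exists s : 'I_n -> S,
    [/\ injective s, forall i, loc (s i) = (P i).1
      & forall v, basis M [set s i | i : 'I_n & v \in tree_vertices D (P i)]].

Definition bounded (f g : V -> nat) : Prop :=
  forall v, f v <= #|[set i | (P i).1 == v]| <= g v.

Definition limited (alpha beta : nat) : Prop := alpha <= n <= beta.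

End Properties.

Definition has_hypertree_packing (V E S : finType) (H : E -> {set V})
    (loc : S -> V) (M : matroid S) (f g : V -> nat) (alpha beta : nat) : Prop :=
  exists (n : nat) (P : 'I_n -> V * {set E}) (D : E -> {set V}),
    trimming H D /\
    [/\ tree_packing D P, matroid_based P D loc M, bounded P f g
      & limited n alpha beta].

Definition crossing (V E : finType) (H : E -> {set V}) (P : {set {set V}}) :
    nat :=
  #|[set e | ~~ [exists X in P, H e \subset X]]|.

(* Main.v *)
Require Import Defs.
From mathcomp Require Import all_boot all_order all_algebra.
From mathcomp Require Import zify.
Set Implicit Arguments. Unset Strict Implicit. Unset Printing Implicit Defensive.
Local Open Scope nat_scope.

(* The conditions are necessary because a tree meeting j classes of a partition
   has at least j - 1 edges between classes, while for every vertex v of a class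
   X and every subset Y of X at most r(S_Y) of the r(S) trees containing v have
   their root in Y.

   For sufficiency, gamma new edges with free ends amount to gamma copies of the
   hyperedge V, which are trimmed later. One looks for the numbers x(v) of roots
   and the in-degrees m(v) of an orientation of the hyperedges with
     m(X) - i(X) + x(X \ Y) + r(S_Y) >= r(S)   for all Y <= X, X nonempty,
   where i(X) counts the hyperedges inside X. Pairs (X, Y) with equality can be
   uncrossed when their first components meet, so for fixed x a minimal m comes
   with a partition of V into such pairs, which is what (v) and (vi) bound.
   Starting from x = min(r(S_v), g) one decreases x down to a total of at most
   beta; Rado's theorem then selects the roots, and the trees are grown one
   hyperedge at a time. *)

(** * Modular weights on vertex sets, and partitions from union-closed families *)

Section Weights.
Variable V : finType.
Implicit Types (X Y : {set V}) (w : V -> nat).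

Definition weight w X := \sum_(v in X) w v.

Lemma weightID w X Y : weight w X = weight w (X :&: Y) + weight w (X :\: Y).
Proof. exact: big_setID. Qed.

Lemma weightUI w X Y :
  weight w (X :|: Y) + weight w (X :&: Y) = weight w X + weight w Y.
Proof.
rewrite (weightID w (X :|: Y) X) setUK setDUl setDv set0U.
by rewrite (weightID w Y X) [Y :&: X]setIC; lia.
Qed.

Lemma weight_subset w X Y : X \subset Y -> weight w X <= weight w Y.
Proof. by move=> /setIidPr sXY; rewrite (weightID w Y X) sXY leq_addr. Qed.

Lemma weightD1 w X v : v \in X -> weight w X = w v + weight w (X :\ v).
Proof. exact: big_setD1. Qed.

Lemma weight1 w v : weight w [set v] = w v.
Proof. exact: big_set1. Qed.

Lemma weightT w : weight w setT = \sum_v w v.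
Proof. by apply: eq_bigl => v; rewrite inE. Qed.

Lemma leq_weight w1 w2 X : (forall v, w1 v <= w2 v) -> weight w1 X <= weight w2 X.
Proof. by move=> le12; apply: leq_sum. Qed.

Lemma weight_partition w (P : {set {set V}}) :
  partition P setT -> \sum_(X in P) weight w X = weight w setT.
Proof. by move=> partP; rewrite /weight (set_partition_big _ partP). Qed.

Definition decr w v : V -> nat := fun u => w u - (u == v).

Lemma decr_id w v : decr w v v = (w v).-1.
Proof. by rewrite /decr eqxx subn1. Qed.

Lemma weight_decr w v X :
  0 < w v -> weight w X = weight (decr w v) X + (v \in X).
Proof.
move=> wv; have out (Z : {set V}) : v \notin Z -> weight w Z = weight (decr w v) Z.
  move=> vZ; apply: eq_bigr => u uZ; rewrite /decr.
  by case: eqP uZ vZ => [->|_]; [case: (v \in Z)|rewrite subn0].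
case vX: (v \in X); last by rewrite addn0; apply: out; rewrite vX.
rewrite !(weightD1 _ vX) (out (X :\ v)) ?setD11 // decr_id; lia.
Qed.

Lemma sum_eq_of_leq (I : finType) (A : {set I}) (a b : I -> nat) :
  {in A, forall i, a i <= b i} -> \sum_(i in A) b i <= \sum_(i in A) a i ->
  {in A, forall i, a i = b i}.
Proof.
move=> leab leba i iA; move: leba.
rewrite (big_setD1 i iA) (big_setD1 (F := a) i iA) /=.
have : \sum_(j in A :\ i) a j <= \sum_(j in A :\ i) b j.
  by apply: leq_sum => j /setD1P[_ /leab].
have := leab i iA; lia.
Qed.

(** The classes are the inclusionwise maximal members of [T]: if two of them meet, their union is in
    [T], so they coincide. *)
Lemma partition_of_union_closed (T : pred {set V}) :
  ~~ T set0 ->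
  (forall X Y, T X -> T Y -> X :&: Y != set0 -> T (X :|: Y)) ->
  (forall v, exists2 X, T X & v \in X) ->
  exists2 P, partition P setT & {in P, forall X, T X}.
Proof.
move=> T0 TU Tcov; exists [set X | maxset T X]; last first.
  by move=> X; rewrite inE => /maxsetp.
apply/and3P; split; last by rewrite inE; apply: contraNN T0 => /maxsetp.
  rewrite eqEsubset subsetT; apply/subsetP => v _; have [X TX vX] := Tcov v.
  have [A maxA /subsetP sXA] := maxset_exists TX.
  by apply/bigcupP; exists A; rewrite ?inE // sXA.
apply/trivIsetP => A B; rewrite !inE => maxA maxB; apply: contraR.
rewrite -setI_eq0 => meetAB.
have TAB := TU _ _ (maxsetp maxA) (maxsetp maxB) meetAB.
have <- := maxsetsup maxA TAB (subsetUl _ _).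
by rewrite (maxsetsup maxB TAB (subsetUr _ _)).
Qed.

End Weights.

(** * Matroid rank, closure and bases *)

Section Matroids.
Variables (S : finType) (M : matroid S).
Implicit Types A B C : {set S}.

Definition mspan A := [set s | M (s |: A) == M A].

Lemma rkU1 s A : M (s |: A) <= (M A).+1.
Proof.
have := rk_submod M [set s] A; have := rk_card M [set s].
by rewrite cards1; lia.
Qed.

Lemma rkT A : M A <= M setT. Proof. exact: rk_mono (subsetT A). Qed.

Lemma rk0 : M set0 = 0.
Proof. by have := rk_card M set0; rewrite cards0; lia. Qed.

Lemma mspan_mono A B : A \subset B -> mspan A \subset mspan B.
Proof.
move=> sAB; apply/subsetP => s; rewrite !inE => /eqP clA.
have := rk_submod M (s |: A) B; rewrite -setUA (setUidPr sAB).
have : M A <= M ((s |: A) :&: B) by apply: rk_mono; rewrite subsetI subsetUr.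
have := rk_mono M (subsetUr [set s] B); lia.
Qed.

Lemma sub_mspan A : A \subset mspan A.
Proof. by apply/subsetP => s sA; rewrite inE (setUidPr _) ?sub1set. Qed.

Lemma rkU_mspan A B : B \subset mspan A -> M (A :|: B) = M A.
Proof.
move cardB: #|B| => n; elim: n => [|n IHn] in B cardB *.
  by move/eqP: cardB; rewrite cards_eq0 => /eqP-> _; rewrite setU0.
case: (set_0Vmem B) => [B0|[s sB]] sBA; first by rewrite B0 cards0 in cardB.
rewrite -(setD1K sB) setUCA.
have sB'A : B :\ s \subset mspan A by apply: subset_trans sBA; apply: subD1set.
have : s \in mspan (A :|: B :\ s).
  by apply/(subsetP (mspan_mono (subsetUl _ _)))/(subsetP sBA).
rewrite inE => /eqP->; apply: IHn => //.
by move: cardB; rewrite (cardsD1 s) sB => -[].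
Qed.

Lemma rk_mspan A B : B \subset mspan A -> M B <= M A.
Proof. by move=> /rkU_mspan <-; apply/rk_mono/subsetUr. Qed.

Lemma mspan_trans A B : B \subset mspan A -> mspan B \subset mspan A.
Proof.
move=> sBA; apply: subset_trans (mspan_mono (subsetUr A B)) _.
apply/subsetP => s; rewrite !inE => /eqP; rewrite (rkU_mspan sBA) => eqs.
rewrite eqn_leq (rk_mono M (subsetUr _ _)) -eqs andbT rk_mono //.
by rewrite setUS // subsetUl.
Qed.

Lemma indep0 : independent M set0.
Proof. by rewrite /independent rk0 cards0. Qed.

Lemma indepS A B : A \subset B -> independent M B -> independent M A.
Proof.
move=> sAB /eqP indB; rewrite /independent eqn_leq rk_card.
have := rk_submod M A (B :\: A); rewrite setDE setICA setICr setI0 rk0 -setDE.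
have -> : A :|: B :\: A = B by rewrite setDE setUIr setUCr setIT (setUidPr sAB).
by rewrite indB; have := rk_card M (B :\: A); have := cardsDS sAB;
  have := subset_leq_card sAB; lia.
Qed.

Lemma indepU1 s A : independent M A -> s \notin mspan A -> independent M (s |: A).
Proof.
move=> /eqP indA; rewrite inE => sA.
have s'A : s \notin A by apply: contraNN sA => sA; rewrite (setUidPr _) ?sub1set.
rewrite /independent cardsU1 s'A -indA eqn_leq rkU1 /= add1n ltn_neqAle eq_sym.
by rewrite sA rk_mono ?subsetUr.
Qed.

(** An element of [A] outside the span of [B] could be added to [B], so [B] spans [A]. *)
Lemma rk_maxset_indep A B :
  maxset (fun C => independent M C && (C \subset A)) B -> M B = M A.
Proof.
move=> maxB; have /andP[indB sBA] := maxsetp maxB.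
rewrite -(rkU_mspan (A := B) (B := A)) ?(setUidPr sBA) //.
apply/subsetP => s sA; case sB: (s \in mspan B) => //.
have indsB := indepU1 indB (negbT sB).
have := maxsetsup maxB _ (subsetUr [set s] B).
rewrite indsB subUset sub1set sA sBA => /(_ isT) eqB.
by rewrite inE eqB eqxx in sB.
Qed.

Lemma rk_basis B : basis M B -> M B = M setT.
Proof.
move=> /maxsetP[indB maxB]; apply: rk_maxset_indep; apply/maxsetP.
by split; [rewrite indB subsetT|move=> C /andP[/maxB + _]].
Qed.

Lemma basisE B : basis M B = independent M B && (M B == M setT).
Proof.
apply/idP/andP => [basB|[indB /eqP rkB]].
  by rewrite (rk_basis basB) (maxsetp basB).
apply/maxsetP; split=> // C /eqP indC sBC; apply/eqP.
by rewrite eq_sym eqEcard sBC -indC -(eqP indB) rkB rkT.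
Qed.

Lemma extend_indep A B n :
  A \subset B -> independent M A -> #|A| <= n <= M B ->
  exists C : {set S}, [/\ A \subset C, C \subset B, independent M C & #|C| = n].
Proof.
move=> sAB indA /andP[leAn lenB].
elim: n leAn lenB => [|n IHn] leAn lenB.
  by exists A; split=> //; lia.
case: (ltngtP #|A| n.+1) leAn => // [ltAn _|<- _]; last by exists A.
have [C [sAC sCB indC cardC]] := IHn ltAn (ltnW lenB).
case/boolP: (B \subset mspan C) => [/rk_mspan|/subsetPn[s sB sC]].
  by rewrite (eqP indC); lia.
exists (s |: C); split; first by rewrite (subset_trans sAC) ?subsetUr.
- by rewrite subUset sub1set sB.
- exact: indepU1.
rewrite cardsU1 cardC; suff -> : s \notin C by [].
by apply: contraNN sC; apply/subsetP/sub_mspan.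
Qed.

(** For [s] in [A], the sets [B :\ s] and [B :\: (A :\ s)] have union [B] and intersection
    [B :\: A], so by submodularity each deleted coloop costs one more unit of rank. *)
Lemma rkD_coloops A B :
  A \subset B -> {in A, forall s, M (B :\ s) < M B} -> M (B :\: A) + #|A| <= M B.
Proof.
move cardA: #|A| => n; elim: n => [|n IHn] in A cardA *.
  by move=> _ _; rewrite addn0 rk_mono ?subsetDl.
case: (set_0Vmem A) => [A0|[s sA]] sAB coloopA; first by rewrite A0 cards0 in cardA.
have cardAs : #|A :\ s| = n by move: cardA; rewrite (cardsD1 s) sA => -[].
have := IHn _ cardAs (subset_trans (subD1set A s) sAB).
move/(_ (fun t tA => coloopA t (subsetP (subD1set A s) _ tA))).
have sB := subsetP sAB _ sA.
have := rk_submod M (B :\ s) (B :\: (A :\ s)).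
have -> : B :\ s :|: B :\: (A :\ s) = B.
  apply/setP => t; rewrite !inE; case: eqP => [->|_]; rewrite ?sB //=.
  by case: (t \in B); rewrite ?andbF.
have -> : (B :\ s) :&: (B :\: (A :\ s)) = B :\: A.
  apply/setP => t; rewrite !inE; case: eqP => [->|_]; rewrite ?sA //=.
  by case: (t \in B); rewrite ?andbF ?andbT.
have := coloopA s sA; lia.
Qed.

End Matroids.

Lemma set1n0 (T : finType) (v : T) : [set v] != set0.
Proof. by apply/set0Pn; exists v; rewrite inE. Qed.

(** * Counting hyperedges inside vertex sets *)

Section Inner.
Variables (V E : finType) (H : E -> {set V}).
Implicit Types (X Y : {set V}) (F : {set E}).

Definition inner F X := #|[set e in F | H e \subset X]|.

Lemma inner_supermod F X Y :
  inner F X + inner F Y <= inner F (X :&: Y) + inner F (X :|: Y).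
Proof.
rewrite /inner -cardsUI addnC leq_add // subset_leq_card //.
  apply/subsetP => e; rewrite !inE => /andP[/andP[-> sX] /andP[_ sY]].
  by rewrite subsetI sX.
apply/subsetP => e; rewrite !inE -andb_orr => /andP[-> /orP[]] sHe.
  exact: subset_trans sHe (subsetUl _ _).
exact: subset_trans sHe (subsetUr _ _).
Qed.

Lemma leq_inner F X : inner F X <= #|F|.
Proof. by apply/subset_leq_card/subsetP => e; rewrite inE => /andP[]. Qed.

Lemma innerT F : inner F setT = #|F|.
Proof. by congr #|pred_of_set _|; apply/setP => e; rewrite inE subsetT andbT. Qed.

Hypothesis hH : is_hypergraph H.

Lemma inner1 F v : inner F [set v] = 0.
Proof.
apply/eqP; rewrite cards_eq0; apply/eqP/setP => e; rewrite !inE.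
apply/negP => /andP[_ /subset_leq_card]; rewrite cards1.
by have := hH e; lia.
Qed.

(** A hyperedge is nonempty, so it lies in at most one of the disjoint members of [P], and in none
    if it is crossing. *)
Lemma sum_inner_crossing (P : {set {set V}}) :
  trivIset P -> \sum_(X in P) inner setT X + crossing H P <= #|E|.
Proof.
move=> trivP; rewrite -[leqRHS](cardsC [set e | [exists X in P, H e \subset X]]).
apply: leq_add; last first.
  by apply/subset_leq_card/subsetP => e; rewrite !inE.
rewrite /inner -sum1dep_card.
under eq_bigr => X _ do rewrite -sum1dep_card big_mkcond /=.
rewrite exchange_big /= [leqRHS]big_mkcond /=; apply: leq_sum => e _.
case: existsP => [[X /andP[PX sHX]]|noX]; last first.
  rewrite big1 // => X PX; case: ifP => // /andP[_ sHX].
  by case: noX; exists X; rewrite PX.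
rewrite (big_setD1 X PX) /= in_setT sHX big1 // => Y /setD1P[YX PY].
case: ifP => // /andP[_ sHY].
have /trivIsetP/(_ _ _ PY PX YX)/pred0P disj := trivP.
have /card_gt0P[v He] : 0 < #|H e| by apply: ltnW.
by have /= := disj v; rewrite (subsetP sHX) ?(subsetP sHY).
Qed.

End Inner.

(** * Feasible vectors and uncrossing of tight pairs *)

Section Feasible.
Variables (V E : finType) (H : E -> {set V}) (k : nat).
Implicit Types (X Y : {set V}) (m x : V -> nat) (rho : {set V} -> nat).

Definition submodular rho :=
  forall X Y, rho (X :&: Y) + rho (X :|: Y) <= rho X + rho Y.

(* [m] is the in-degree vector of an orientation of the hyperedges and [x] the
   number of roots at each vertex: since [inner setT X] hyperedges have their
   head in [X] without entering [X], the condition says that the roots in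
   [X :\: Y] and the hyperedges entering [X] provide what is missing from the
   rank of [Y]. *)
Definition feasible rho m x := forall X Y, X != set0 -> Y \subset X ->
  k + inner H setT X + weight x Y <= weight m X + weight x X + rho Y.

Definition tight rho m x X Y := [&& X != set0, Y \subset X &
  k + inner H setT X + weight x Y == weight m X + weight x X + rho Y].

(** Weights are modular, [inner] is supermodular and [rho] submodular, so adding the two equalities
    leaves no slack in the inequalities for union and intersection. The first components must meet
    because feasibility says nothing about an empty one. *)
Lemma tightUI rho m x X1 Y1 X2 Y2 : submodular rho -> feasible rho m x ->
  tight rho m x X1 Y1 -> tight rho m x X2 Y2 -> X1 :&: X2 != set0 ->
  tight rho m x (X1 :|: X2) (Y1 :|: Y2) /\ tight rho m x (X1 :&: X2) (Y1 :&: Y2).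
Proof.
move=> subrho feas /and3P[X1n0 sYX1 /eqP t1] /and3P[X2n0 sYX2 /eqP t2] meetX.
have Un0 : X1 :|: X2 != set0 by rewrite setU_eq0 negb_and X1n0.
have sU := setUSS sYX1 sYX2; have sI := setISS sYX1 sYX2.
have := feas _ _ Un0 sU; have := feas _ _ meetX sI.
have := inner_supermod H setT X1 X2; have := subrho Y1 Y2.
have := weightUI m X1 X2; have := weightUI x X1 X2; have := weightUI x Y1 Y2.
by rewrite /tight Un0 meetX sU sI /=; split; apply/eqP; lia.
Qed.

Hypothesis hH : is_hypergraph H.

(** Induction on the total of [m]: a vertex in no tight first component allows [m] to be lowered
    there. Once tight first components cover [V], they are closed under union of meeting members,
    and the maximal ones form the partition. *)
Lemma feasible_tight_partition rho x :
  submodular rho -> (forall v, rho [set v] <= k) ->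
  exists m (P : {set {set V}}) (Yof : {set V} -> {set V}),
  [/\ feasible rho m x, partition P setT & {in P, forall X, tight rho m x X (Yof X)}].
Proof.
move=> subrho rho1.
have [m0 feas0] : exists m, feasible rho m x.
  (* A single vertex of [X] already contributes enough for [k + inner H setT X]. *)
  exists (fun=> k + #|E|) => X Y /set0Pn[v vX] sYX.
  have := weight_subset x sYX; have := leq_inner H setT X; rewrite cardsT.
  by rewrite (weightD1 (fun=> k + #|E|) vX); lia.
have [n] := ubnP (weight m0 setT); elim: n => // n IHn in m0 feas0 *.
move=> ltmn; pose T X := [exists Y, tight rho m0 x X Y].
have [/forallP coverT|] := boolP [forall v, [exists X, T X && (v \in X)]].
  have [|X1 X2|v|P partP tightP] := @partition_of_union_closed _ T.
  - by apply/existsP => -[Y]; rewrite /tight eqxx.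
  - move=> /existsP[Y1 t1] /existsP[Y2 t2] meetX; apply/existsP.
    by exists (Y1 :|: Y2); have [] := tightUI subrho feas0 t1 t2 meetX.
  - by have /existsP[X /andP[TX vX]] := coverT v; exists X.
  exists m0, P, (fun X => odflt set0 [pick Y | tight rho m0 x X Y]).
  split=> // X /tightP /existsP[Y tXY].
  by case: pickP => [//|/(_ Y)]; rewrite tXY.
case/forallPn => v /existsPn loose.
have noTight X Y : X != set0 -> Y \subset X -> v \in X ->
    k + inner H setT X + weight x Y < weight m0 X + weight x X + rho Y.
  move=> Xn0 sYX vX; rewrite ltn_neqAle feas0 // andbT.
  have := loose X; rewrite vX andbT; apply: contraNneq => tXY.
  by apply/existsP; exists Y; rewrite /tight Xn0 sYX tXY eqxx.
(* The pair of [[set v]] with itself is not tight, and [rho [set v] <= k]. *)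
have mv : 0 < m0 v.
  have := noTight [set v] [set v] (set1n0 v) (subxx _) (set11 v).
  rewrite inner1 // !weight1; have := rho1 v; lia.
apply: (IHn (decr m0 v)) => [X Y Xn0 sYX|].
  have := feas0 X Y Xn0 sYX; have := noTight X Y Xn0 sYX.
  rewrite (weight_decr X mv); case: (v \in X) => [/(_ isT)|_]; lia.
by have := weight_decr setT mv; rewrite inE; lia.
Qed.

End Feasible.

(** * Choosing the number of roots at each vertex *)

Section RootNumbers.
Variables (V E : finType) (H : E -> {set V}) (k : nat) (rho : {set V} -> nat).
Hypothesis hH : is_hypergraph H.
Hypothesis subrho : submodular rho.
Hypothesis rhok : forall Y, rho Y <= k.
Implicit Types (X Y : {set V}) (m x : V -> nat) (P : {set {set V}}).

(** The form of (v), with [x = g] and [N = g(V)], and of (vi), with [x = f] and [N = beta]: [Yof]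
    replaces the maxima, crossing hyperedges are counted as [#|E|] minus those inside a class, and
    subtracted terms change sides. *)
Definition partition_bound x N := forall P (Yof : {set V} -> {set V}),
  partition P setT -> {in P, forall X, Yof X \subset X} ->
  \sum_(X in P) (k + inner H setT X + weight x (Yof X)) <=
    N + #|E| + \sum_(X in P) rho (Yof X).

Lemma tight_partition_sum m x P (Yof : {set V} -> {set V}) :
  partition P setT -> {in P, forall X, tight H k rho m x X (Yof X)} ->
  \sum_(X in P) (k + inner H setT X + weight x (Yof X)) =
    weight m setT + weight x setT + \sum_(X in P) rho (Yof X).
Proof.
move=> partP tightP; rewrite -!(weight_partition _ partP) -!big_split /=.
by apply: eq_bigr => X /tightP/and3P[_ _ /eqP].
Qed.

Lemma feasible_of_partition_bound x :
  partition_bound x (weight x setT) ->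
  exists2 m, feasible H k rho m x & weight m setT <= #|E|.
Proof.
move=> bound; have rho1 v : rho [set v] <= k by [].
have [m [P [Yof [feas partP tightP]]]] :=
  feasible_tight_partition hH x subrho rho1.
exists m => //; have := tight_partition_sum partP tightP.
have := bound P Yof partP (fun X PX => proj1 (andP (proj2 (andP (tightP X PX))))).
lia.
Qed.

Lemma eq_feasible m x1 x2 :
  x1 =1 x2 -> feasible H k rho m x1 -> feasible H k rho m x2.
Proof.
move=> eqx feas X Y Xn0 sYX; have := feas X Y Xn0 sYX.
by rewrite /weight !(eq_bigr _ (fun v _ => eqx v)).
Qed.

(** Only pairs with [v] in [X :\: Y] lose anything. For these, feasibility of [(X, v |: Y)] and
    submodularity of [rho] leave a slack of at least [x v - rho [set v]]. *)
Lemma feasible_decr m x v : rho [set v] < x v ->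
  feasible H k rho m x -> feasible H k rho m (decr x v).
Proof.
move=> ltx feas X Y Xn0 sYX; have := feas X Y Xn0 sYX.
have x0 : 0 < x v by lia.
rewrite !(weight_decr _ x0); case vY: (v \in Y).
  by rewrite (subsetP sYX _ vY); lia.
case vX: (v \in X); last by lia.
have sUX : v |: Y \subset X by rewrite subUset sub1set vX.
have := feas X (v |: Y) Xn0 sUX.
rewrite (weightD1 _ (setU11 v Y)) setU1K ?vY // !(weight_decr _ x0) vX vY.
by have := subrho [set v] Y; lia.
Qed.

Lemma feasible_minn m x : feasible H k rho m x ->
  feasible H k rho m (fun v => minn (rho [set v]) (x v)).
Proof.
have [n] := ubnP (weight x setT); elim: n => // n IHn in x *; move=> ltxn feas.
have [/forallP lex|] := boolP [forall v, x v <= rho [set v]].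
  by apply: eq_feasible feas => v; have := lex v; lia.
case/forallPn => v; rewrite -ltnNge => ltx.
have x0 : 0 < x v by lia.
apply: (@eq_feasible _ (fun u => minn (rho [set u]) (decr x v u))) => [u|].
  by rewrite /decr; case: eqP => [->|_]; lia.
apply: IHn; last exact: feasible_decr.
by have := weight_decr setT x0; rewrite inE; lia.
Qed.

(** The bound for [g] makes the starting vector good. The bound for [f] shows that, while the total
    exceeds [beta], some coordinate above [f] can be lowered. *)
Lemma root_numbers (f g : V -> nat) (alpha beta : nat) :
  (forall v, f v <= minn (rho [set v]) (g v)) -> alpha <= beta ->
  alpha <= \sum_v minn (rho [set v]) (g v) ->
  partition_bound g (weight g setT) -> partition_bound f beta ->
  exists m x, [/\ feasible H k rho m x, weight m setT <= #|E|,
    forall v, f v <= x v <= minn (rho [set v]) (g v)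
    & alpha <= weight x setT <= beta].
Proof.
move=> lefg leab lea boundg boundf.
pose good x := exists2 m, feasible H k rho m x & weight m setT <= #|E|.
pose g' v := minn (rho [set v]) (g v).
suff [x [[m feas mE] lex lexb]] : exists x, [/\ good x,
    forall v, f v <= x v <= g' v & alpha <= weight x setT <= beta].
  by exists m, x.
have [x0 [good0 le0 lea0]] : exists x, [/\ good x,
    forall v, f v <= x v <= g' v & alpha <= weight x setT].
  exists g'; split; last by rewrite weightT.
    have [m feas mE] := feasible_of_partition_bound boundg.
    by exists m => //; apply: feasible_minn.
  by move=> v; rewrite lefg /=.
have [n] := ubnP (weight x0 setT); elim: n => // n IHn in x0 good0 le0 lea0 *.
move=> ltxn; have [lexb|ltbx] := leqP (weight x0 setT) beta.
  by exists x0; split; rewrite ?lea0.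
have [m feas mE] := good0.
pose free := [set v | f v < x0 v].
have tightT (w : V) : tight H k rho m x0 setT setT.
  have Tn0 : setT != set0 :> {set V} by apply/set0Pn; exists w; rewrite inE.
  have := feas setT setT Tn0 (subxx _); rewrite /tight Tn0 subxx /= innerT cardsT.
  by have := rhok setT; lia.
(* The case treated first is a vertex [v] of [free] for which [escape v w] fails for some [w]: there
   [x0] can be lowered. *)
pose escape (v w : V) := [exists p : {set V} * {set V},
  [&& tight H k rho m x0 p.1 p.2, w \in p.1 & v \notin p.2]].
have [/forallP escapes|] := boolP [forall v in free, forall w, escape v w];
    last first.
  case/forallPn => v; rewrite negb_imply => /andP[]; rewrite inE => ltfx.
  have xv : 0 < x0 v by lia.
  case/forallPn => w noesc.
  have [m' [P [Yof [feas' partP tightP]]]] :=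
    feasible_tight_partition hH (decr x0 v) subrho (fun v => rhok [set v]).
  have := weight_decr setT xv; rewrite inE => weightx0.
  have [leE|ltE] := leqP (weight m' setT) #|E|.
    apply: (IHn (decr x0 v)); [by exists m'| |by lia|by lia].
    move=> u; have := le0 u; rewrite /decr; case: eqP => [->|_]; lia.
  have sumP := tight_partition_sum partP tightP.
  have sYX X : X \in P -> X != set0 /\ Yof X \subset X.
    by case/tightP/and3P.
  have [/eqP coverP _ _] := and3P partP.
  have /bigcupP[X PX wX] : w \in cover P by rewrite coverP inE.
  case/negP: noesc; apply/existsP; exists (X, Yof X) => /=; rewrite wX.
  (* As [m'] exceeds [#|E|], the sum of [a] is at least that of [b], although [a Z <= b Z] on every
     class. Equality on the class [X] of [w] makes [(X, Yof X)] tight for [x0] with [v] outside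
     [Yof X], which is an escape. *)
  pose a Z := k + inner H setT Z + weight (decr x0 v) (Yof Z).
  pose b Z := weight m Z + weight x0 Z + rho (Yof Z).
  have eqab : {in P, forall Z, a Z = b Z}.
    apply: sum_eq_of_leq => [Z PZ|].
      have [Zn0 sYZ] := sYX Z PZ; have := feas Z (Yof Z) Zn0 sYZ.
      by rewrite /a /b (weight_decr _ xv); lia.
    by rewrite /a sumP /b !big_split /= !(weight_partition _ partP); lia.
  have [Xn0 sYX'] := sYX X PX; have := feas X (Yof X) Xn0 sYX'.
  have := eqab X PX; rewrite /a /b /tight Xn0 sYX' /= !(weight_decr (Yof X) xv).
  by case: (v \in Yof X) => /=; lia.
(* On a set disjoint from [free] the vectors [x0] and [f] agree, so a partition into such tight
   pairs can be compared with the bound for [f]. *)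
exfalso; pose T X := [exists Y, tight H k rho m x0 X Y && [disjoint Y & free]].
have [|X1 X2|w|P partP TP] := @partition_of_union_closed _ T.
- by apply/existsP => -[Y]; rewrite /tight eqxx.
- move=> /existsP[Y1 /andP[t1 d1]] /existsP[Y2 /andP[t2 d2]] meetX.
  apply/existsP; exists (Y1 :|: Y2); have [-> _] := tightUI subrho feas t1 t2 meetX.
  by rewrite -setI_eq0 setIUl setU_eq0 !setI_eq0 d1.
(* Intersecting with an escape pair removes a free vertex from [Y] and keeps [w] in [X], so a pair
   with fewest free vertices in [Y] has none. *)
- pose Q (p : {set V} * {set V}) := tight H k rho m x0 p.1 p.2 && (w \in p.1).
  have Q0 : Q (setT, setT) by rewrite /Q (tightT w) inE.
  case: (arg_minnP (fun p => #|p.2 :&: free|) Q0) => -[X Y] /andP[/= tXY wX] minXY.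
  exists X => //; apply/existsP; exists Y; rewrite tXY -setI_eq0 /=.
  apply/set0Pn => -[v /setIP[vY vfree]].
  have := escapes v; rewrite vfree => /forallP/(_ w)/existsP[[X' Y'] /=].
  case/and3P => tX'Y' wX' vY'.
  have meetX : X :&: X' != set0 by apply/set0Pn; exists w; rewrite inE wX.
  have [_ tI] := tightUI subrho feas tXY tX'Y' meetX.
  have := minXY (X :&: X', Y :&: Y'); rewrite /Q tI inE wX wX' /= => /(_ isT).
  rewrite leqNgt proper_card // properE.
  rewrite setIAC subsetIl /=; apply/subsetPn; exists v; first by rewrite inE vY.
  by rewrite !inE (negbTE vY') andbF.
pose Yof X := odflt set0 [pick Y | tight H k rho m x0 X Y && [disjoint Y & free]].
have YofP X : X \in P -> tight H k rho m x0 X (Yof X) /\ [disjoint Yof X & free].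
  case/TP/existsP => Y tXY; rewrite /Yof.
  by case: pickP => [? /andP|/(_ Y)]; last rewrite tXY.
have tightP : {in P, forall X, tight H k rho m x0 X (Yof X)} by move=> X /YofP[].
have boundP := boundf P Yof partP (fun X PX => proj1 (andP (proj2 (andP (tightP X PX))))).
have eqfx : \sum_(X in P) (k + inner H setT X + weight f (Yof X)) =
    \sum_(X in P) (k + inner H setT X + weight x0 (Yof X)).
  apply: eq_bigr => X PX; congr (_ + _); apply: eq_bigr => v vY.
  have [_ dYf] := YofP X PX.
  have := disjointFr dYf vY; rewrite inE; have := le0 v; lia.
move: boundP; rewrite eqfx (tight_partition_sum partP tightP).
(* [V] is nonempty because [x0] has positive total. Tightness of [setT] then gives
   [#|E| <= weight m setT], so the bound reads [weight x0 setT <= beta], a contradiction. *)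
have /existsP[w _] : [exists w : V, true].
  apply: contraT => /existsPn noV; move: ltbx; rewrite /weight big1 // => v.
  by have := noV v.
have /and3P[_ _ /eqP] := tightT w; rewrite innerT cardsT; have := rhok setT.
lia.
Qed.

End RootNumbers.

(** * Selecting the roots by Rado's argument *)

Section RootChoice.
Variables (V E S : finType) (H : E -> {set V}) (loc : S -> V) (M : matroid S).
Implicit Types (X Y : {set V}) (A B : {set S}) (m x : V -> nat).

(** For [A = setT] this is the rank of $S_Y$; the set [A] is then shrunk towards the selected
    roots. *)
Definition located_rank A Y := M (A :&: located loc Y).

Lemma located_rank_submod A : submodular (located_rank A).
Proof.
move=> X Y; rewrite /located_rank /located preimsetI preimsetU setIUr setIIr.
exact: rk_submod.
Qed.

Lemma located_rank_mono A B Y : A \subset B -> located_rank A Y <= located_rank B Y.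
Proof. by move=> sAB; apply/rk_mono/setSI. Qed.

(* Rado's argument: in an inclusionwise minimal [A] that keeps [m] and [x]
   feasible, the elements located at [v] are coloops of a common tight set. *)
Lemma root_selection k m x :
  (forall v, x v <= M (located loc [set v])) ->
  feasible H k (located_rank setT) m x ->
  exists A, [/\ feasible H k (located_rank A) m x,
    forall v, independent M (A :&: located loc [set v])
    & forall v, #|A :&: located loc [set v]| = x v].
Proof.
move=> lex feasT.
pose feasb A := [forall X : {set V}, forall Y : {set V}, (X != set0) && (Y \subset X) ==>
  (k + inner H setT X + weight x Y <= weight m X + weight x X + located_rank A Y)].
have feasP A : reflect (feasible H k (located_rank A) m x) (feasb A).
  apply: (iffP forallP) => [feas X Y Xn0 sYX|feas X].
    by have /forallP/(_ Y) := feas X; rewrite Xn0 sYX.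
  by apply/forallP => Y; apply/implyP => /andP[]; apply: feas.
have [A /minsetP[/feasP feasA minA] _] := minset_exists (introT (feasP setT) feasT).
have small v : independent M (A :&: located loc [set v]) /\
    #|A :&: located loc [set v]| <= x v.
  set Av := A :&: located loc [set v].
  case: (set_0Vmem Av) => [->|[s0 s0v]]; first by rewrite indep0 cards0.
  pose Q (p : {set V} * {set V}) :=
    tight H k (located_rank A) m x p.1 p.2 && (v \in p.2).
  (* By minimality of [A], deleting [s] violates some inequality; a deletion costs at most one unit
     of rank, so that inequality was tight, and its [Y] contains the location [v] of [s]. *)
  have coloop s : s \in Av -> exists2 p, Q p &
      located_rank (A :\ s) p.2 < located_rank A p.2.
    case/setIP => sA; rewrite !inE => /eqP sv.
    have : ~~ feasb (A :\ s).
      apply/negP => /minA/(_ (subD1set A s)) /setP/(_ s).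
      by rewrite setD11 sA.
    case/forallPn => X /forallPn[Y]; rewrite negb_imply -ltnNge.
    case/andP => /andP[Xn0 sYX] viol; exists (X, Y) => /=; last first.
      have := feasA X Y Xn0 sYX; lia.
    have vY : v \in Y.
      apply: contraLR viol => vY; rewrite -leqNgt.
      suff -> : located_rank (A :\ s) Y = located_rank A Y by apply: feasA.
      congr (M _); apply/setP => t; rewrite !inE.
      by case: eqP => [->|//]; rewrite sv (negbTE vY) !andbF.
    rewrite /Q /= /tight Xn0 sYX vY andbT /=.
    have := feasA X Y Xn0 sYX; move: viol; rewrite /located_rank.
    have -> : (A :\ s) :&: located loc Y = (A :&: located loc Y) :\ s.
      by rewrite setIDAC.
    have := rkU1 M s ((A :&: located loc Y) :\ s).
    rewrite setD1K; last by rewrite !inE sA sv.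
    lia.
  have [p0 Qp0 _] := coloop s0 s0v.
  case: (arg_minnP (fun p : {set V} * {set V} => #|p.2|) Qp0).
  move=> -[X Y] /andP[/= tXY vY] minXY.
  set AY := A :&: located loc Y.
  have sAvY : Av \subset AY by rewrite setIS // preimsetS // sub1set.
  have vX : v \in X by case/and3P: tXY => _ /subsetP ->.
  (* As [Y] is smallest, intersecting with the pair of [s] gives [Y] inside [Y']; a coloop of the
     larger set remains one in the smaller. *)
  have coloopY : {in Av, forall s, M (AY :\ s) < M AY}.
    move=> s sAv; have [[X' Y'] /andP[/= tX'Y' vY'] lts] := coloop s sAv.
    have vX' : v \in X' by case/and3P: tX'Y' => _ /subsetP ->.
    have meetX : X :&: X' != set0 by apply/set0Pn; exists v; rewrite inE vX.
    have [_ tI] := tightUI (@located_rank_submod A) feasA tXY tX'Y' meetX.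
    have := minXY (X :&: X', Y :&: Y'); rewrite /Q tI inE vY vY' /= => /(_ isT).
    move=> leYI; have eqY : Y :&: Y' = Y.
      by apply/eqP; rewrite eqEcard subsetIl.
    have sAYY' : AY \subset A :&: located loc Y'.
      by rewrite setIS // preimsetS // -eqY subsetIr.
    have sAY : s \in AY by apply: (subsetP sAvY).
    rewrite ltnNge; apply: contraL lts => leAY; rewrite -leqNgt.
    have : s \in mspan M (AY :\ s).
      by rewrite inE setD1K // eqn_leq leAY rk_mono ?subD1set.
    move/(subsetP (mspan_mono M (setSD [set s] sAYY'))).
    rewrite inE setD1K ?(subsetP sAYY') // /located_rank => /eqP->.
    by rewrite setIDAC.
  (* Deleting [Av] lowers the rank of [AY] by at least [#|Av|], which gives independence. Comparing
     the tight pair [(X, Y)] with [(X, Y :\ v)] bounds this drop by [x v]. *)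
  have := rkD_coloops sAvY coloopY; split.
    have := rk_submod M Av (AY :\: Av); have := rk_card M Av.
    rewrite setDE setICA setICr setI0 rk0 -setDE.
    have -> : Av :|: AY :\: Av = AY by rewrite setDE setUIr setUCr setIT (setUidPr sAvY).
    by rewrite /independent; lia.
  have /and3P[Xn0 sYX /eqP eqXY] := tXY.
  have sY'X : Y :\ v \subset X by apply: subset_trans sYX; apply: subD1set.
  have := feasA X (Y :\ v) Xn0 sY'X; move: eqXY; rewrite (weightD1 _ vY).
  rewrite /located_rank -/AY; have -> : A :&: located loc (Y :\ v) = AY :\: Av.
    apply/setP => t; rewrite !inE.
    by case: (t \in A) => //=; rewrite andbT.
  lia.
(* [A] may have fewer than [x v] elements at [v]. Adding independent ones up to that number only
   increases ranks, so feasibility survives. *)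
have ext v : exists C : {set S}, [&& A :&: located loc [set v] \subset C,
    C \subset located loc [set v], independent M C & #|C| == x v].
  have [indA leA] := small v.
  have [|C [sAC sC indC cardC]] := @extend_indep _ M _ (located loc [set v]) (x v)
    (subsetIr A _) indA.
    by rewrite leA lex.
  by exists C; rewrite sAC sC indC cardC eqxx.
have {}ext v := sigW (ext v); pose C v := sval (ext v).
have CP v : [/\ A :&: located loc [set v] \subset C v,
    C v \subset located loc [set v], independent M (C v) & #|C v| = x v].
  by rewrite /C; case: (ext v) => /= D /and4P[? ? ? /eqP].
have CE v : (\bigcup_u C u) :&: located loc [set v] = C v.
  have [_ sCv _ _] := CP v; apply/setP => s; rewrite !inE.
  apply/andP/idP => [[/bigcupP[u _ sCu] /eqP <-]|sCv'].
    have [_ sCu' _ _] := CP u.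
    by have := subsetP sCu' s sCu; rewrite !inE => /eqP->.
  split; first by apply/bigcupP; exists v.
  by have := subsetP sCv s sCv'; rewrite !inE.
exists (\bigcup_v C v); split=> [X Y Xn0 sYX|v|v]; rewrite ?CE; last 2 first.
- by have [] := CP v.
- by have [] := CP v.
apply: leq_trans (feasA X Y Xn0 sYX) _; rewrite leq_add2l located_rank_mono //.
apply/subsetP => s sA; apply/bigcupP; exists (loc s) => //.
by have [/subsetP-> //] := CP (loc s); rewrite !inE sA eqxx.
Qed.

End RootChoice.

(** * Growing the trees one hyperedge at a time *)

Section Growing.
Variables (V E S : finType) (H : E -> {set V}) (M : matroid S).
Hypothesis hH : is_hypergraph H.
Implicit Types (X Y : {set V}) (B : V -> {set S}) (F : {set E}) (m : V -> nat).

Definition active B X := \bigcup_(v in X) B v.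

Lemma active1 B v : active B [set v] = B v.
Proof. exact: big_set1. Qed.

Lemma sub_active B X v : v \in X -> B v \subset active B X.
Proof. exact: bigcup_sup. Qed.

Lemma activeU B X Y : active B (X :|: Y) = active B X :|: active B Y.
Proof. exact: bigcup_setU. Qed.

Lemma activeI B X Y : active B (X :&: Y) \subset active B X :&: active B Y.
Proof.
rewrite subsetI; apply/andP; split; apply/bigcupsP => v /setIP[vX vY];
  exact: sub_active.
Qed.

Lemma active_submod B X Y :
  M (active B (X :&: Y)) + M (active B (X :|: Y)) <= M (active B X) + M (active B Y).
Proof.
have := rk_submod M (active B X) (active B Y); rewrite activeU.
have := rk_mono M (activeI B X Y); lia.
Qed.

Lemma trim_exists : exists D : E -> {set V}, trimming H D.
Proof.
have pairs e : exists D : {set V}, (#|D| == 2) && (D \subset H e).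
  have /card_gt1P[u [v [ue ve uv]]] := hH e.
  by exists [set u; v]; rewrite cards2 uv subUset !sub1set ue.
have {}pairs e := sigW (pairs e); exists (fun e => sval (pairs e)).
by split=> e; case: (pairs e) => D /= /andP[/eqP].
Qed.

Lemma adjacent_sym (D : E -> {set V}) T : symmetric (adjacent D T).
Proof. by move=> x y; apply: eq_existsb => e; rewrite setUC. Qed.

(* [B v] is the set of the roots of the trees that contain [v]; the pair of a
   hyperedge [e] and a root [s] active at [u] but not spanned at [v] extends the
   tree of [s] from [u] to [v]. Such an extension preserves the hypothesis for
   [u], [v] inside a minimal tight set on which the ranks are not constant. *)
Lemma grow_trees F B m :
  (forall v, independent M (B v)) -> weight m setT <= #|F| ->
  (forall X, X != set0 -> M setT + inner H F X <= weight m X + M (active B X)) ->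
  exists (B' : V -> {set S}) (D : E -> {set V}) (T : S -> {set E}),
  [/\ forall v, basis M (B' v), trimming H D, forall s, T s \subset F,
      forall s t, s != t -> [disjoint T s & T t]
    & [/\ forall v, B v \subset B' v,
          forall s e v, e \in T s -> v \in D e -> s \in B' v
        & forall s v, s \in B' v ->
            exists2 u, s \in B u & connect (adjacent D (T s)) u v]].
Proof.
have [n] := ubnP #|F|; elim: n => // n IHn in F B m *.
move=> ltFn indB mF feas.
have [/forallP full|] := boolP [forall v, M (B v) == M setT].
  have [D trimD] := trim_exists; exists B, D, (fun=> set0); split=> //.
  - by move=> v; rewrite basisE indB full.
  - by move=> s; rewrite sub0set.
  - by move=> s t _; rewrite -setI_eq0 setI0.
  - by split=> // [s e v|s v sBv]; [rewrite inE|exists v].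
case/forallPn => v0 v0T.
have feasT : #|F| <= weight m setT.
  have Tn0 : setT != set0 :> {set V} by apply/set0Pn; exists v0; rewrite inE.
  by have := feas _ Tn0; rewrite innerT; have := rkT M (active B setT); lia.
pose tightX X := (X != set0) &&
  (M setT + inner H F X == weight m X + M (active B X)).
pose Q X := tightX X && [exists v in X, M (B v) < M (active B X)].
have QT : Q setT.
  have Tn0 : setT != set0 :> {set V} by apply/set0Pn; exists v0; rewrite inE.
  have := feas _ Tn0; rewrite /Q /tightX Tn0 innerT /=.
  have := rkT M (active B setT) => leT feasT'.
  apply/andP; split; first lia.
  by apply/existsP; exists v0; rewrite inE; have := rkT M (B v0); lia.
have [X /minsetP[/andP[tX /existsP[v1 /andP[v1X ltv1]]] minX] _] := minset_exists QT.
have /andP[Xn0 /eqP eqX] := tX.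
have [e [u [v [s [eF sHeX /andP[ue ve] /andP[sBu sBv]]]]]] : exists e u v s,
    [/\ e \in F, H e \subset X, (u \in H e) && (v \in H e)
      & (s \in B u) && (s \notin mspan M (B v))].
  (* Suppose there is none. With [X1] the vertices of [X] whose roots are spanned at [v1], every
     hyperedge inside [X] lies inside [X1] or inside its complement in [X]. Adding the inequalities
     of the two parts contradicts tightness of [X], since [M (B v1) < M (active B X)]. *)
  pose found := [exists e in F, (H e \subset X) && [exists u in H e,
    [exists v in H e, ~~ (B u \subset mspan M (B v))]]].
  have [/existsP[e /and3P[eF sHeX /existsP[u /andP[ue /existsP[v /andP[ve]]]]]]|] :=
    boolP found.
    by case/subsetPn => s sBu sBv; exists e, u, v, s; rewrite ue ve sBu sBv.
  rewrite negb_exists => /forallP nofound.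
  have same e u v : e \in F -> H e \subset X -> u \in H e -> v \in H e ->
      B u \subset mspan M (B v).
    move=> eF sHeX ue ve; have := nofound e; rewrite eF sHeX /= negb_exists.
    by move/forallP/(_ u); rewrite ue negb_exists => /forallP/(_ v); rewrite ve negbK.
  pose X1 := [set u in X | B u \subset mspan M (B v1)].
  have rkX1 : M (active B X1) <= M (B v1).
    by apply/rk_mspan/bigcupsP => u; rewrite inE => /andP[].
  have X1n0 : X1 != set0 by apply/set0Pn; exists v1; rewrite inE v1X sub_mspan.
  have sX1X : X1 \subset X by apply/subsetP => u; rewrite inE => /andP[].
  have X2n0 : X :\: X1 != set0.
    apply: contraL ltv1; rewrite setD_eq0 => sXX1.
    have -> : X = X1 by apply/eqP; rewrite eqEsubset sXX1.
    by rewrite -leqNgt.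
  have leX : inner H F X <= inner H F X1 + inner H F (X :\: X1).
    rewrite /inner -cardsUI; apply: leq_trans (leq_addr _ _).
    apply/subset_leq_card/subsetP => e; rewrite !inE => /andP[eF sHeX].
    rewrite eF /=; have [//|/subsetPn[w we wX1]] := boolP (H e \subset X1).
    apply/subsetP => u ue; rewrite inE (subsetP sHeX) // andbT inE.
    apply: contraNN wX1; rewrite !inE => /andP[_ sBu]; rewrite (subsetP sHeX) //=.
    exact: subset_trans (same e w u eF sHeX we ue) (mspan_trans sBu).
  have := feas _ X1n0; have := feas _ X2n0; have := rkT M (active B (X :\: X1)).
  have := weightID m X X1; rewrite (setIidPr sX1X); lia.
have nsBv : M (B v) < M (s |: B v).
  by move: sBv; rewrite inE ltn_neqAle eq_sym rk_mono ?subsetUr // andbT.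
have mv : 0 < m v.
  have := feas _ (set1n0 v); rewrite inner1 // weight1 active1.
  by move: nsBv (rkT M (s |: B v)); clear; lia.
pose B1 w := if w == v then s |: B v else B w.
have sBB1 w : B w \subset B1 w by rewrite /B1; case: eqP => [->|_] //; apply: subsetUr.
have sact Y : active B Y \subset active B1 Y.
  by apply/bigcupsP => w wY; apply: subset_trans (sBB1 w) (sub_active _ wY).
have B1v Y : v \in Y -> s |: active B Y \subset active B1 Y.
  move=> vY; rewrite subUset sact andbT sub1set; apply: (subsetP (sub_active _ vY)).
  by rewrite /B1 eqxx setU11.
have feas1 Y : Y != set0 ->
    M setT + inner H (F :\ e) Y <= weight (decr m v) Y + M (active B1 Y).
  move=> Yn0; have feasY := feas Y Yn0; have wY := weight_decr Y mv.
  have leB := rk_mono M (sact Y).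
  have leY : inner H (F :\ e) Y <= inner H F Y.
    by apply/subset_leq_card/subsetP => c; rewrite !inE -andbA => /and3P[_ ->].
  have [vY|vY] := boolP (v \in Y); last first.
    move: wY feasY; rewrite (negbTE vY) addn0 => <-; move: leB leY.
    by clear; lia.
  rewrite vY addn1 in wY; case: (boolP (H e \subset Y)) => sHeY.
    have : inner H F Y = (inner H (F :\ e) Y).+1.
      rewrite /inner (cardsD1 e) inE eF sHeY add1n; congr _.+1.
      by apply: eq_card => c; rewrite !inE andbA.
    by move: wY feasY leB; clear; lia.
  have leBs := rk_mono M (B1v Y vY).
  have [eqY|neY] := eqVneq (M setT + inner H F Y) (weight m Y + M (active B Y));
    last by move: neY wY feasY leB leY; clear; lia.
  (* The remaining case: [Y] is tight, contains [v] but not all of [H e], so adding [s] must raise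
     its rank. If not, uncrossing makes [X :&: Y] tight, and minimality of [X] bounds its rank by
     [M (B v)]. Submodularity for [active B X] and [s |: active B Y] then contradicts [s] being
     unspanned at [v]. *)
  suff : M (active B Y) < M (s |: active B Y).
    by move: eqY wY leBs leY; clear; lia.
  rewrite ltnNge; apply/negP => leYs.
  have vX : v \in X by apply: (subsetP sHeX).
  have meet : X :&: Y != set0 by apply/set0Pn; exists v; rewrite inE vX.
  have Un0 : X :|: Y != set0 by rewrite setU_eq0 negb_and Xn0.
  have := feas _ meet; have := feas _ Un0; have := inner_supermod H F X Y.
  have := weightUI m X Y; have := active_submod B X Y => subB wUI supI fU fI.
  have tI : tightX (X :&: Y).
    rewrite /tightX meet; apply/eqP.
    by move: eqX eqY subB wUI supI fU fI; clear; lia.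
  have : M (active B (X :&: Y)) <= M (B v).
    rewrite leqNgt; apply/negP => ltI.
    have : X :&: Y = X.
      apply: minX (subsetIl _ _); rewrite /Q tI /=; apply/existsP; exists v.
      by rewrite inE vX vY.
    by move/setIidPl => sXY; rewrite (subset_trans sHeX sXY) in sHeY.
  have sX : s |: active B X = active B X.
    apply/setUidPr; rewrite sub1set; apply: (subsetP (sub_active B _) _ sBu).
    exact: (subsetP sHeX).
  have := rk_submod M (s |: active B X) (s |: active B Y); rewrite sX.
  have : M (active B (X :|: Y)) <= M (active B X :|: (s |: active B Y)).
    by rewrite activeU rk_mono // setUS // subsetUr.
  have : M (s |: B v) <= M (active B X :&: (s |: active B Y)).
    apply: rk_mono; rewrite -sX -setUIr setUS // subsetI.
    by rewrite !sub_active.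
  move=> leI leU lesub leIv.
  by move: leI leU lesub leIv leYs nsBv eqX eqY subB wUI supI fU fI; clear; lia.
have indB1 w : independent M (B1 w).
  by rewrite /B1; case: eqP => // _; apply: indepU1.
have ltF : #|F :\ e| < n by move: ltFn; rewrite (cardsD1 e F) eF; clear; lia.
have mF1 : weight (decr m v) setT <= #|F :\ e|.
  have := weight_decr setT mv; rewrite inE.
  by move: mF; rewrite (cardsD1 e F) eF; clear; lia.
have [B' [D [T [basB' [gD sDH] sTF disjT [sB1B' endsT connT]]]]] :=
  IHn _ _ _ ltF indB1 mF1 feas1.
have uv : u != v by apply: contraNneq sBv => <-; apply: (subsetP (sub_mspan _ _)).
(* The hyperedge [e] is trimmed to [u], [v] and joins the tree of [s]; the trees from the induction
   avoid it. *)
pose D' c := if c == e then [set u; v] else D c.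
pose T' t := if t == s then e |: T s else T t.
have eT t : e \notin T t by apply/negP => /(subsetP (sTF t)); rewrite setD11.
have adjT t : subrel (connect (adjacent D (T t))) (connect (adjacent D' (T' t))).
  apply: connect_sub => x y /existsP[c /andP[cT Dc]]; apply: connect1.
  apply/existsP; exists c; rewrite /D' /T'.
  case: (c =P e) cT => [->|_ cT]; first by rewrite (negbTE (eT t)).
  by rewrite Dc andbT; case: eqP => [<-|_] //; rewrite inE cT orbT.
exists B', D', T'; split=> //.
- split=> c; rewrite /D'; first by case: ifP => _; rewrite ?cards2 ?uv.
  by case: eqP => [->|_] //; rewrite subUset !sub1set ue.
- move=> t; rewrite /T'; case: eqP => _.
    by rewrite subUset sub1set eF; apply: subset_trans (sTF s) (subD1set _ _).
  exact: subset_trans (sTF t) (subD1set _ _).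
- move=> t1 t2 t12; rewrite /T'; have noe t : [disjoint [set e] & T t].
    by rewrite disjoints1 eT.
  case: eqP => [eq1|_]; case: eqP => [eq2|_].
  + by rewrite eq1 eq2 eqxx in t12.
  + by rewrite -setI_eq0 setIUl setU_eq0 !setI_eq0 noe disjT // -eq1.
  + rewrite disjoint_sym -setI_eq0 setIUl setU_eq0 !setI_eq0 noe disjT //.
    by rewrite -eq2 eq_sym.
  + exact: disjT.
split=> [w|t c w|t w tB'w].
- exact: subset_trans (sBB1 w) (sB1B' w).
- rewrite /T' /D'; case: (c =P e) => [->|ce]; last first.
    case: eqP => [->|_]; last exact: endsT.
    by rewrite in_setU1 (introF eqP ce) /=; apply: endsT.
  case: (t =P s) => [-> _|_]; last by rewrite (negbTE (eT t)).
  case/set2P => ->; apply: (subsetP (sB1B' _)); first exact: (subsetP (sBB1 u)).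
  by rewrite /B1 eqxx setU11.
have [y tB1y yw] := connT t w tB'w.
have {}yw := adjT _ _ _ yw.
have [tBy|tBy] := boolP (t \in B y); first by exists y.
move: tB1y; rewrite /B1; case: eqP => [yv|_]; last by rewrite (negbTE tBy).
(* Here the path starts at [v], where [s] is active only through the extension; it is prolonged
   backwards along [e] to [u]. *)
rewrite -yv in_setU1 (negbTE tBy) orbF => /eqP ts; exists u; first by rewrite ts.
apply: connect_trans yw; apply: connect1; apply/existsP; exists e.
by rewrite /T' /D' ts !eqxx setU11 yv eqxx.
Qed.

End Growing.

(** * Spanning trees, and tree edges between classes of a partition *)

Section GraphTrees.
Variables (V E : finType) (D : E -> {set V}).
Hypothesis graphD : is_graph D.
Implicit Types (U W X : {set V}) (T : {set E}).

Lemma connect_path T (p q : V * E) c :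
  path (fun p q : V * E => D p.2 == [set p.1; q.1]) q (rcons c p) ->
  {subset map snd (q :: c) <= T} -> connect (adjacent D T) q.1 p.1.
Proof.
elim: c q => [|q' c IHc] q /= /andP[Dq pathc] sT.
  by apply: connect1; apply/existsP; exists q.2; rewrite sT ?inE ?eqxx.
apply: (@connect_trans _ _ q'.1).
  by apply: connect1; apply/existsP; exists q.2; rewrite sT ?inE ?eqxx.
by apply: IHc pathc _ => e ce; apply: sT; rewrite inE ce orbT.
Qed.

(** A minimal edge set reaching all of [U] from [r] has no cycle: an edge of a cycle could be
    dropped, its ends being joined by the rest of the cycle. *)
Lemma spanning_tree T r U :
  r \in U -> {in T, forall e, D e \subset U} ->
  {in U, forall v, connect (adjacent D T) r v} ->
  exists T' : {set E},
    [/\ T' \subset T, rooted_tree D (r, T') & tree_vertices D (r, T') = U].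
Proof.
move=> rU sTU connT.
pose Q (T' : {set E}) := [forall v in U, connect (adjacent D T') r v].
have QT : Q T by apply/forallP => v; apply/implyP => /connT.
have [T' /minsetP[QT' minT'] sT'T] := minset_exists QT.
have connT' v : v \in U -> connect (adjacent D T') r v.
  by move=> vU; have /forallP/(_ v) := QT'; rewrite vU.
have sym := adjacent_sym D.
have verts : tree_vertices D (r, T') = U.
  apply/eqP; rewrite eqEsubset; apply/andP; split.
    rewrite subUset sub1set rU; apply/bigcupsP => e /= eT'.
    by apply: sTU; apply: (subsetP sT'T).
  apply/subsetP => v /connT'; rewrite (sym_connect_sym (sym T')).
  case/connectP => -[_ ->|w p /= /andP[/existsP[e /andP[eT' /eqP De]] _] _].
    exact: setU11.
  by rewrite inE; apply/orP; right; apply/bigcupP; exists e; rewrite ?De ?set21.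
exists T'; split=> //; rewrite /rooted_tree verts; split=> /=.
- by apply/set0Pn; exists r.
- by move=> e eT'; apply: sTU; apply: (subsetP sT'T).
- move=> u v uU vU; apply: connect_trans (connT' v vU).
  by rewrite (sym_connect_sym (sym T')) connT'.
case=> [[]|[v1 e1] c [_ sT' _ /= /andP[e1c _]]] //.
case: c => [|q c] in sT' e1c *; rewrite /= => /andP[/eqP De1 pathc].
  (* A cycle of length one would be a loop. *)
  by have := graphD e1; rewrite De1 setUid cards1.
have e1T' : e1 \in T' by apply: sT'; rewrite inE eqxx.
suff /minT'/(_ (subD1set _ _))/setP/(_ e1) : Q (T' :\ e1) by rewrite setD11 e1T'.
have connq : connect (adjacent D (T' :\ e1)) q.1 v1.
  apply: (@connect_path _ (v1, e1)) pathc _ => e ec; rewrite inE; apply/andP; split.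
    by rewrite inE; apply: contraNneq e1c => <-.
  by apply: sT'; rewrite inE ec orbT.
have connq' := connq; rewrite (sym_connect_sym (sym _)) in connq'.
apply/forallP => v; apply/implyP => /connT'.
apply: (connect_sub (e := adjacent D T')) => x y /existsP[e /andP[eT' /eqP De]].
have [ee1|ne] := eqVneq e e1; last first.
  by apply: connect1; apply/existsP; exists e; rewrite !inE ne eT' De eqxx.
have : x \in [set x; y] by rewrite set21.
have : y \in [set x; y] by rewrite set22.
rewrite -De ee1 De1 => /set2P[->|->] /set2P[->|->] //; exact: connect0.
Qed.

(** A vertex set [W] is grown from [r] along edges of [T]: each newly met class is entered by a
    crossing edge not yet inside [W]. A maximal [W] is closed under adjacency, hence equals [U]. *)
Lemma classes_leq_crossing (P : {set {set V}}) T r U :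
  partition P setT -> r \in U -> {in T, forall e, D e \subset U} ->
  {in U, forall v, connect (adjacent D T) r v} ->
  #|[set X in P | (r \notin X) && (X :&: U != set0)]| <=
  #|[set e in T | ~~ [exists X in P, D e \subset X]]|.
Proof.
move=> /and3P[/eqP coverP trivP P0] rU sTU connT.
pose classes W := [set X in P | (r \notin X) && (X :&: W != set0)].
pose cross W :=
  [set e in T | (D e \subset W) && ~~ [exists X in P, D e \subset X]].
pose Q W := [&& r \in W, W \subset U & #|classes W| <= #|cross W|].
have Q0 : Q [set r].
  rewrite /Q set11 sub1set rU /=; suff -> : classes [set r] = set0 by rewrite cards0.
  apply/setP => X; rewrite !inE; apply/negP => /and3P[_ rX /set0Pn[v]].
  by rewrite !inE => /andP[vX /eqP vr]; rewrite -vr vX in rX.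
have [W /maxsetP[/and3P[rW sWU leW] maxW] _] := maxset_exists Q0.
suff WU : W = U.
  rewrite -WU; apply: leq_trans leW _; apply/subset_leq_card/subsetP => e.
  by rewrite !inE => /and3P[-> _].
apply/eqP; rewrite eqEsubset sWU; apply/subsetP => z zU.
have [closedW|] := boolP [forall e in T, forall a, forall b,
    (D e == [set a; b]) && (a \in W) ==> (b \in W)].
  suff : closed (adjacent D T) (mem W).
    by move=> cl; rewrite -[z \in W](closed_connect cl (connT z zU)).
  have step a b : adjacent D T a b -> a \in W -> b \in W.
    case/existsP => e /andP[eT De] aW.
    have /forallP/(_ e) := closedW; rewrite eT => /forallP/(_ a)/forallP/(_ b).
    by rewrite De aW.
  move=> a b adj; apply/idP/idP; first exact: step.
  by apply: step; rewrite adjacent_sym.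
case/forallPn => e; rewrite negb_imply => /andP[eT /forallPn[a /forallPn[b]]].
rewrite negb_imply => /andP[/andP[/eqP De aW] bW].
have [aDe bDe] : a \in D e /\ b \in D e by rewrite De set21 set22.
have bU : b \in U by apply: (subsetP (sTU e eT)).
suff /maxW/(_ (subsetUr _ _)) eqW : Q (b |: W) by rewrite -eqW setU11 in bW.
rewrite /Q inE rW orbT subUset sub1set bU sWU /=.
have Pb : b \in cover P by rewrite coverP inE.
set Xb := pblock P b; have PXb : Xb \in P by apply: pblock_mem.
have bXb : b \in Xb by rewrite mem_pblock.
have sclasses : classes (b |: W) \subset Xb |: classes W.
  apply/subsetP => X; rewrite !inE => /and3P[PX rX /set0Pn[v /setIP[vX]]].
  case/setU1P => [vb|vW]; first by rewrite /Xb (def_pblock trivP PX) ?eqxx -?vb.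
  by rewrite PX rX; apply/orP; right; apply/set0Pn; exists v; rewrite inE vX.
have scross : cross W \subset cross (b |: W).
  apply/subsetP => c; rewrite !inE => /and3P[-> sDc ->]; rewrite andbT.
  exact: subset_trans sDc (subsetUr _ _).
(* Either [b] brings no new class, or [e] is a new crossing edge, because its end [a] lies in [W]
   and so outside [Xb]. *)
have [old|] := boolP ((r \in Xb) || (Xb \in classes W)).
  apply: leq_trans (leq_trans leW (subset_leq_card scross)).
  apply/subset_leq_card/subsetP => X Xc; have /setU1P[eqX|//] := subsetP sclasses X Xc.
  by move: Xc old; rewrite eqX inE => /and3P[_ /negbTE-> _].
rewrite negb_or => /andP[rXb newXb].
apply: leq_trans (subset_leq_card sclasses) _; rewrite cardsU1 newXb add1n.
apply: leq_ltn_trans leW _; apply: proper_card; rewrite properE scross.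
apply/subsetPn; exists e; last by rewrite !inE eT De subUset !sub1set (negbTE bW) andbF.
rewrite !inE eT De subUset !sub1set setU11 inE aW orbT /=.
apply/negP => /existsP[X /andP[PX]]; rewrite subUset !sub1set => /andP[aX bX].
case/negP: newXb; rewrite inE PXb rXb; apply/set0Pn; exists a.
by rewrite inE aW andbT /Xb (def_pblock trivP PX bX).
Qed.

End GraphTrees.

(** * Necessity: double counting in a given packing *)

Lemma exchange_card (I J : finType) (A : {set I}) (B : {set J}) (R : I -> J -> bool) :
  \sum_(i in A) #|[set j in B | R i j]| = \sum_(j in B) #|[set i in A | R i j]|.
Proof.
have cardE (K : finType) (C : {set K}) (p : pred K) :
    #|[set c in C | p c]| = \sum_(c in C) p c.
  rewrite -sum1dep_card big_mkcondr /=; apply: eq_bigr => c _; by case: (p c).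
under eq_bigr do rewrite cardE.
by under [RHS]eq_bigr do rewrite cardE; apply: exchange_big.
Qed.

Lemma card_preim_weight (V I : finType) (r : I -> V) (X : {set V}) :
  #|[set i | r i \in X]| = weight (fun v => #|[set i | r i == v]|) X.
Proof.
have := exchange_card X [set: I] (fun v i => r i == v).
have -> : \sum_(v in X) #|[set i in setT | r i == v]| =
    weight (fun v => #|[set i | r i == v]|) X.
  by apply: eq_bigr => v _; apply: eq_card => i; rewrite !inE.
move=> ->; rewrite -sum1dep_card big_mkcond /=; apply: eq_big => [i|i _].
  by rewrite inE.
have [rX|rX] := boolP (r i \in X).
  by rewrite (_ : [set _ in X | _] = [set r i]) ?cards1 //; apply/setP => v;
    rewrite !inE eq_sym; case: eqP => [->|]; rewrite ?rX ?andbF.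
rewrite (_ : [set _ in X | _] = set0) ?cards0 //; apply/setP => v.
by rewrite !inE; case: eqP => [<-|]; rewrite ?(negbTE rX) ?andbF.
Qed.

Section PackingBound.
Variables (V E S : finType) (H : E -> {set V}) (loc : S -> V) (M : matroid S).
Variables (n : nat) (T : 'I_n -> V * {set E}) (D : E -> {set V}) (s : 'I_n -> S).
Hypotheses (trimD : trimming H D) (packT : tree_packing D T).
Hypotheses (inj_s : injective s) (loc_s : forall i, loc (s i) = (T i).1).
Hypothesis base_s :
  forall v, basis M [set s i | i : 'I_n & v \in tree_vertices D (T i)].
Implicit Types (X Y : {set V}) (P : {set {set V}}).

Definition root_count v := #|[set i | (T i).1 == v]|.

Lemma indep_roots (J : {set 'I_n}) v :
  {in J, forall i, v \in tree_vertices D (T i)} -> independent M (s @: J).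
Proof.
move=> vJ; have := base_s v; rewrite basisE => /andP[+ _]; apply: indepS.
by apply/imsetS/subsetP => i iJ; rewrite inE vJ.
Qed.

Lemma root_count_leq_rk v : root_count v <= M (located loc [set v]).
Proof.
have ind : independent M (s @: [set i | (T i).1 == v]).
  by apply: (@indep_roots _ v) => i; rewrite inE => /eqP <-; apply: setU11.
rewrite /root_count -(card_imset _ inj_s) -(eqP ind).
apply/rk_mono/subsetP => t /imsetP[i + ->{t}].
by rewrite inE => /eqP rv; rewrite !inE loc_s rv.
Qed.

Lemma rkT_leq_trees v Y :
  M setT <= M (located loc Y) +
    #|[set i | (v \in tree_vertices D (T i)) && ((T i).1 \notin Y)]|.
Proof.
have base := base_s v; rewrite -(rk_basis base).
rewrite basisE in base; have /andP[/eqP-> _] := base; rewrite card_imset //.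
set J := [set i | v \in tree_vertices D (T i)].
rewrite -(cardsID [set i | (T i).1 \in Y] J); apply: leq_add; last first.
  by apply/subset_leq_card/subsetP => i; rewrite !inE andbC.
rewrite -(card_imset _ inj_s).
have /eqP <- : independent M (s @: (J :&: [set i | (T i).1 \in Y])).
  by apply: (@indep_roots _ v) => i; rewrite !inE => /andP[].
apply/rk_mono/subsetP => t /imsetP[i + ->{t}].
by rewrite !inE loc_s => /andP[].
Qed.

(** At a vertex of [X], the trees rooted outside [Yof X] are rooted in [X :\: Yof X] or reach [X]
    from another class. Summed over [P], the latter are at most the crossing edges of all trees. *)
Lemma packing_partition_bound P (Yof : {set V} -> {set V}) :
  partition P setT -> {in P, forall X, Yof X \subset X} ->
  \sum_(X in P) (M setT - M (located loc (Yof X))) <=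
    \sum_(X in P) weight root_count (X :\: Yof X) + crossing H P.
Proof.
move=> partP sYX; have /and3P[_ trivP P0] := partP.
have [gD sDH] := trimD; have [treeT disjT] := packT.
pose meets X := [set i in setT | ((T i).1 \notin X) &&
  (X :&: tree_vertices D (T i) != set0)].
apply: (@leq_trans (\sum_(X in P) (weight root_count (X :\: Yof X) + #|meets X|))).
  apply: leq_sum => X PX.
  have /set0Pn[v vX] : X != set0 by apply: contraNneq P0 => <-.
  rewrite leq_subLR; apply: leq_trans (rkT_leq_trees v (Yof X)) _.
  rewrite leq_add2l -card_preim_weight -cardsUI; apply: leq_trans (leq_addr _ _).
  apply/subset_leq_card/subsetP => i; rewrite !inE => /andP[vi ->] /=.
  case: (_ \in X) => //=; apply/set0Pn; exists v.
  by rewrite !inE vX vi.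
rewrite big_split leq_add2l exchange_card.
pose cut e := ~~ [exists X in P, D e \subset X].
apply: (@leq_trans
    (\sum_(i in [set: 'I_n]) #|[set e in [set e | cut e] | e \in (T i).2]|)).
  apply: leq_sum => i _; have [_ sTi connTi _] := treeT i.
  have r0 : (T i).1 \in tree_vertices D (T i) by apply: setU11.
  have := classes_leq_crossing partP r0 sTi (fun v vi => connTi _ _ r0 vi).
  by move/leq_trans; apply; apply/subset_leq_card/subsetP => e; rewrite !inE andbC.
rewrite exchange_card; apply: (@leq_trans (\sum_(e in [set e | cut e]) 1)).
  (* The trees are edge-disjoint, so each edge is counted once. *)
  apply: leq_sum => e _; apply/card_le1P => i; rewrite !inE /= => eTi j.
  rewrite !inE /=; apply/idP/eqP => [eTj|-> //]; apply/eqP; apply: contraLR eTj => ij.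
  have := disjT j i ij; rewrite disjoint_sym => /disjointFr/(_ eTi) -> //.
rewrite sum1_card; apply/subset_leq_card/subsetP => e; rewrite !inE.
apply: contraNN => /existsP[X /andP[PX sHX]]; apply/existsP; exists X.
by rewrite PX (subset_trans (sDH e)).
Qed.

End PackingBound.

(** * Sufficiency: from feasible vectors to a packing *)

Lemma crossing_add_edges (V E E' : finType) (H : E -> {set V}) (F : E' -> {set V})
    (P : {set {set V}}) :
  crossing (add_edges H F) P = crossing H P + crossing F P.
Proof.
by rewrite /crossing -!sum1dep_card big_mkcond big_sumType /= -!big_mkcond.
Qed.

Lemma crossing_full (V E : finType) (P : {set {set V}}) :
  setT \notin P -> crossing (fun _ : E => setT) P = #|E|.
Proof.
move=> PT; rewrite /crossing -[RHS]cardsT; apply: eq_card => e; rewrite !inE.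
apply/negP => /existsP[X /andP[PX]]; rewrite subTset => /eqP XT.
by rewrite -XT PX in PT.
Qed.

Lemma partition_setT (V : finType) (P : {set {set V}}) :
  partition P setT -> setT \in P -> P = [set setT].
Proof.
case/and3P => _ /trivIsetP trivP P0 PT; apply/setP => X; rewrite inE.
apply/idP/eqP => [PX|-> //]; apply/eqP; apply: contraNT P0 => XT.
by have := trivP _ _ PX PT XT; rewrite -setI_eq0 setIT => /eqP <-.
Qed.

(** The selected roots at [v] are the initial [B v] of [grow_trees]. The edge sets obtained are only
    known to be connected, so a spanning tree is taken in each; the trees are indexed by the
    elements of [A]. *)
Lemma has_hypertree_packing_of_feasible (V E S : finType) (H : E -> {set V})
    (hH : is_hypergraph H) (loc : S -> V) (M : matroid S) (f g m x : V -> nat)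
    (alpha beta : nat) :
  feasible H (M setT) (located_rank loc M setT) m x -> weight m setT <= #|E| ->
  (forall v, f v <= x v <= minn (M (located loc [set v])) (g v)) ->
  alpha <= weight x setT <= beta ->
  has_hypertree_packing H loc M f g alpha beta.
Proof.
move=> feas mE lex xab.
have [|A [feasA indA cardA]] := root_selection _ feas.
  by move=> v; have := lex v; lia.
pose B v := A :&: located loc [set v].
have activeB X : active B X = A :&: located loc X.
  apply/setP => s; rewrite !inE; apply/bigcupP/andP => [[v vX]|[sA sX]].
    by rewrite !inE => /andP[-> /eqP->].
  by exists (loc s); rewrite // !inE sA eqxx.
have [|X Xn0|B' [D [T [basB' trimD _ disjT [sBB' endsT connT]]]]] :=
    @grow_trees _ _ _ H M hH setT B m indA.
- by rewrite cardsT.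
(* For [Y = X] the terms in [x] cancel. *)
- have := feasA X X Xn0 (subxx _).
  by rewrite activeB /located_rank; clear; lia.
have B'A s v : s \in B' v -> s \in A.
  by case/connT => u; rewrite inE => /andP[].
have spans s : exists T' : {set E}, s \in A ->
    [/\ T' \subset T s, rooted_tree D (loc s, T')
      & tree_vertices D (loc s, T') = [set v | s \in B' v]].
  have [sA|sA] := boolP (s \in A); last by exists set0.
  have rootB : s \in B' (loc s) by apply: (subsetP (sBB' _)); rewrite !inE sA eqxx.
  have [||v|T' treeT'] :=
      @spanning_tree _ _ D (proj1 trimD) (T s) (loc s) [set v | s \in B' v].
  - by rewrite inE.
  - by move=> e eT; apply/subsetP => v vDe; rewrite inE (endsT s e).
  - by rewrite inE => /connT[u]; rewrite !inE => /andP[_ /eqP->].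
  by exists T'.
have [T' treeT'] := fin_all_exists spans.
pose s (i : 'I_#|A|) := enum_val i.
have sA i : s i \in A by apply: enum_valP.
have cardP (p : pred S) : #|[set i | p (s i)]| = #|[set t in A | p t]|.
  rewrite -(card_imset _ (@enum_val_inj _ (mem A))); apply: eq_card => t.
  rewrite inE; apply/imsetP/andP => [[i + ->]|[tA pt]].
    by rewrite inE; split=> //; apply: sA.
  by exists (enum_rank_in tA t); rewrite ?inE /s enum_rankK_in.
have rootsE v : #|[set i | loc (s i) == v]| = x v.
  by rewrite (cardP (fun t => loc t == v)) -cardA; apply: eq_card => t; rewrite !inE.
exists #|A|, (fun i => (loc (s i), T' (s i))), D; split=> //; split.
- split=> [i|i j ij] /=; first by have [] := treeT' _ (sA i).
  have [sTi _ _] := treeT' _ (sA i); have [sTj _ _] := treeT' _ (sA j).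
  apply: disjointWl sTi _; apply: disjointWr sTj _; apply: disjT.
  by rewrite (inj_eq enum_val_inj).
- exists s; split=> // [|v]; first exact: enum_val_inj.
  suff -> : [set s i | i : 'I_#|A| & v \in tree_vertices D (loc (s i), T' (s i))] =
      B' v by [].
  apply/setP => t.
  apply/imsetP/idP => [[i]|tB].
    by have [_ _ /= verts] := treeT' _ (sA i); rewrite inE verts inE => sB ->.
  have tA := B'A t v tB; exists (enum_rank_in tA t); rewrite /s ?enum_rankK_in //.
  by have [_ _ /= verts] := treeT' _ tA; rewrite inE enum_rankK_in // verts inE.
- by move=> v /=; rewrite rootsE; have := lex v; lia.
have <- : weight x setT = #|A|; last by [].
have := card_preim_weight (fun i => loc (s i)) setT.
rewrite -[RHS](_ : weight x setT = _); last first.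
  by apply: eq_bigr => v _; rewrite rootsE.
move<-; rewrite (_ : [set i | _] = setT) ?cardsT ?card_ord //.
by apply/setP => i; rewrite !inE.
Qed.

(** * Necessity and sufficiency of conditions (i) to (vi) *)

Theorem theorem14 (V E S : finType) (H : E -> {set V}) (hH : is_hypergraph H)
    (loc : S -> V) (alpha beta gamma : nat) (f g : V -> nat) (M : matroid S)
    (hV : 0 < gamma -> 1 < #|V|) :
  (exists F : 'I_gamma -> {set V},
     is_graph F /\
     has_hypertree_packing (add_edges H F) loc M f g alpha beta)
  <->
  [/\ (forall v : V, f v <= minn (M (located loc [set v])) (g v)),
      alpha <= beta,
      alpha <= \sum_(v : V) minn (M (located loc [set v])) (g v)
    & [/\ (forall Y : {set V},
             ((M [set: S])%:Z - (M (located loc Y))%:Z <=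
              Num.min (beta%:Z - (\sum_(y in Y) f y)%N%:Z)
                      (\sum_(y in ~: Y) g y)%N%:Z)%R),
          (forall P : {set {set V}}, partition P [set: V] ->
             \sum_(X in P) \max_(Y : {set V} | Y \subset X)
                (M [set: S] - M (located loc Y) + \sum_(y in Y) g y) <=
             \sum_(v : V) g v + gamma + crossing H P)
        & (forall P : {set {set V}}, partition P [set: V] ->
             \sum_(X in P) \max_(Y : {set V} | Y \subset X)
                (M [set: S] - M (located loc Y) + \sum_(y in Y) f y) <=
             beta + gamma + crossing H P)]].
Proof.
have maxE h (X : {set V}) : exists2 Y : {set V}, Y \subset X &
    \max_(Y : {set V} | Y \subset X)
      (M [set: S] - M (located loc Y) + \sum_(y in Y) h y) =
    M [set: S] - M (located loc Y) + weight h Y.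
  rewrite (bigmax_eq_arg set0) ?sub0set //.
  by case: arg_maxnP => [|Y sYX _]; [exact: sub0set | exists Y].
split=> [[F [gF [n [T [D [trimD [packT [s [inj_s loc_s base_s]] bnd lim]]]]]]]|].
  pose c := root_count T.
  have cfg v : f v <= c v <= g v by apply: bnd.
  have cM v : c v <= M (located loc [set v]) by apply: root_count_leq_rk base_s _.
  have sumc : weight c setT = n.
    rewrite -card_preim_weight -[RHS]card_ord -[RHS]cardsT.
    by apply: eq_card => i; rewrite !inE.
  have /andP[lean lenb] := lim.
  (* Condition (v) is the case [h = w = g]; condition (vi) is [h = f] and [w = c], whose total [n]
     is at most [beta]. *)
  have bound P h w : partition P setT -> (forall v, c v <= w v) ->
      (forall v, h v <= w v) ->
      \sum_(X in P) \max_(Y : {set V} | Y \subset X)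
        (M [set: S] - M (located loc Y) + \sum_(y in Y) h y) <=
      weight w setT + gamma + crossing H P.
    move=> partP lecw lehw; have [Yof sYX YofP] := fin_all_exists2 (maxE h).
    have -> : \sum_(X in P) \max_(Y : {set V} | Y \subset X)
          (M [set: S] - M (located loc Y) + \sum_(y in Y) h y) =
        \sum_(X in P) (M setT - M (located loc (Yof X))) +
        \sum_(X in P) weight h (Yof X).
      by rewrite -big_split; apply: eq_bigr => X _; apply: YofP.
    have := packing_partition_bound trimD packT inj_s loc_s base_s partP
      (fun X _ => sYX X).
    rewrite crossing_add_edges.
    have : crossing F P <= gamma by rewrite -[leqRHS]card_ord max_card.
    have : \sum_(X in P) weight c (X :\: Yof X) + \sum_(X in P) weight h (Yof X) <=
        weight w setT.
      rewrite -big_split -(weight_partition _ partP); apply: leq_sum => X _ /=.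
      rewrite (weightID w X (Yof X)) (setIidPr (sYX X)) addnC.
      by rewrite leq_add ?leq_weight.
    by rewrite /c; clear; lia.
  have missing Y : M setT <= M (located loc Y) + weight c (~: Y).
    (* If [V] is empty then so is [S], every element having a location. *)
    have [v _|noV] := pickP V.
      apply: leq_trans (rkT_leq_trees inj_s loc_s base_s v Y) _.
      rewrite leq_add2l -card_preim_weight; apply/subset_leq_card/subsetP => i.
      by rewrite !inE => /andP[].
    apply: leq_trans (leq_addr _ _); apply/rk_mono/subsetP => t _.
    by have := noV (loc t).
  have sumY (h : V -> nat) (Y : {set V}) : weight h setT = weight h Y + weight h (~: Y).
    by rewrite (weightID h setT Y) setTI setTD.
  split; first by move=> v; have := cfg v; have := cM v; lia.
  - by lia.
  - apply: leq_trans lean _; rewrite -sumc weightT; apply: leq_sum => v _.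
    by have := cfg v; have := cM v; lia.
  split=> [Y|P partP|P partP].
  - have lecg : weight c (~: Y) <= weight g (~: Y).
      by apply: leq_weight => v; have /andP[] := cfg v.
    have lefc : weight f Y <= weight c Y.
      by apply: leq_weight => v; have /andP[] := cfg v.
    have := missing Y; have := sumY c Y; rewrite sumc Order.TotalTheory.le_min.
    rewrite -/(weight f Y) -/(weight g (~: Y)); move: lecg lefc lenb; clear; lia.
  - rewrite -weightT; apply: bound => // v; by have /andP[] := cfg v.
  - have := bound P f c partP (fun v => leqnn _) (fun v => proj1 (andP (cfg v))).
    by rewrite sumc => /leq_trans; apply; rewrite !leq_add2r.
case=> lefg leab lea [rkY boundg boundf].
pose H' := add_edges H (fun _ : 'I_gamma => [set: V]).
have hH' : is_hypergraph H'.
  by case=> [e|i]; [apply: hH | rewrite /= cardsT hV // (leq_trans _ (ltn_ord i))].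
have cardE' : #|{: E + 'I_gamma}| = #|E| + gamma by rewrite card_sum card_ord.
have rhoE Y : located_rank loc M setT Y = M (located loc Y).
  by rewrite /located_rank setTI.
have cond h N :
    (forall P : {set {set V}}, partition P [set: V] ->
      \sum_(X in P) \max_(Y : {set V} | Y \subset X)
        (M [set: S] - M (located loc Y) + \sum_(y in Y) h y) <=
      N + gamma + crossing H P) ->
    (forall Y, M setT + weight h Y <= N + M (located loc Y)) ->
    partition_bound H' (M setT) (located_rank loc M setT) h N.
  move=> bound boundT P Yof partP sYX.
  (* The copies of [V] cross every partition except the one with the single class [V]; that one is
     settled by [boundT], which comes from (iv). *)
  have [PT|PT] := boolP (setT \in P).
    rewrite (partition_setT partP PT) !big_set1 rhoE.
    have := leq_inner H' setT setT; rewrite cardsT.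
    by have := boundT (Yof setT); clear; lia.
  have [_ trivP _] := and3P partP.
  have := sum_inner_crossing hH' trivP.
  rewrite crossing_add_edges crossing_full // card_ord.
  have := bound P partP.
  have : \sum_(X in P) (M setT + weight h (Yof X)) <=
      \sum_(X in P) \max_(Y : {set V} | Y \subset X)
        (M [set: S] - M (located loc Y) + \sum_(y in Y) h y) +
      \sum_(X in P) located_rank loc M setT (Yof X).
    rewrite -big_split; apply: leq_sum => X PX /=; rewrite rhoE.
    have := leq_bigmax_cond
      (F := fun Y : {set V} => M setT - M (located loc Y) + \sum_(y in Y) h y)
      (P := fun Y : {set V} => Y \subset X)
      (Yof X) (sYX X PX).
    rewrite /= -/(weight h (Yof X)); have := rkT M (located loc (Yof X)); clear; lia.
  have -> : \sum_(X in P) (M setT + inner H' setT X + weight h (Yof X)) =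
      \sum_(X in P) (M setT + weight h (Yof X)) + \sum_(X in P) inner H' setT X.
    by rewrite -big_split; apply: eq_bigr => X _; rewrite /= addnAC.
  by clear -cardE'; lia.
have sumY (h : V -> nat) (Y : {set V}) : weight h setT = weight h Y + weight h (~: Y).
  by rewrite (weightID h setT Y) setTI setTD.
have [v|//||//||m [x [feas mE lex xab]]] := root_numbers hH'
  (@located_rank_submod _ _ loc M setT) (fun Y => rkT M _) (f := f) (g := g)
  (alpha := alpha) (beta := beta).
- by rewrite rhoE.
- by under eq_bigr do rewrite rhoE.
- apply: cond => [P partP|Y]; first by rewrite weightT; apply: boundg.
  have := rkY Y; rewrite Order.TotalTheory.le_min -/(weight g (~: Y)) (sumY g Y).
  by clear; lia.
- apply: cond => // Y; have := rkY Y.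
  by rewrite Order.TotalTheory.le_min -/(weight f Y); clear; lia.
have [|n [T [D [[gD sDH] pack]]]] := @has_hypertree_packing_of_feasible _ _ _ H' hH'
    loc M f g m x alpha beta feas mE _ xab.
  by move=> v; rewrite -rhoE.
(* The added edges are the trimmed copies of [V]. *)
exists (fun i => D (inr i)); split=> [i|]; first exact: gD.
exists n, T, D; split=> //; split=> // -[e|i] //=; exact: (sDH (inl e)).
Qed.
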